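(* Consider an instance of the two-group risk assignment problem with $0<\mu_t<N_t$ for $t=1,2$, and suppose there exists a risk assignment for this instance that satisfies all three of the following: (A) calibration within groups, (B) balance for the negative class, and (C) balance for the positive class. Then either the instance allows for perfect prediction, i.e. $p_\sigma\in\{0,1\}$ for every feature vector $\sigma$, or the two groups have equal base rates, i.e. $\mu_1/N_1=\mu_2/N_2$.
   Context: **Instance.** An instance consists of a finite set of feature vectors $\sigma$; a number $p_\sigma\in[0,1]$ for each $\sigma$ (the fraction of people with feature vector $\sigma$ who belong to the positive class; this is the same for both groups); and, for each of two groups $t\in\{1,2\}$, a size $N_t>0$ and a probability distribution $(a_{t\sigma})_\sigma$ over feature vectors ($a_{t\sigma}\ge 0$, $\sum_\sigma a_{t\sigma}=1$). Put $n_{t\sigma}=a_{t\sigma}N_t$ (number of group-$t$ people with feature vector $\sigma$, treated as a real number). Every feature vector is exhibited by someone: $n_{1\sigma}+n_{2\sigma}>0$ for all $\sigma$. The size of the positive class of group $t$ is $\mu_t=\sum_\sigma n_{t\sigma}p_\sigma$, and the base rate of group $t$ is $\mu_t/N_t$. **Risk assignment.** A risk assignment consists of a finite set of bins $b$, a score $v_b\in[0,1]$ for each bin, and numbers $X_{\sigma b}\ge 0$ with $\sum_b X_{\sigma b}=1$ for every $\sigma$ ($X_{\sigma b}$ is the fraction of people with feature vector $\sigma$ assigned to bin $b$, independently of class and group). **Fairness conditions.** - (A) Calibration within groups: for each $t\in\{1,2\}$ and each bin $b$, $\sum_\sigma n_{t\sigma}p_\sigma X_{\sigma b}=v_b\sum_\sigma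 n_{t\sigma}X_{\sigma b}$. - (B) Balance for the negative class: the average score of negative-class members is the same in both groups, i.e. $\frac{1}{N_1-\mu_1}\sum_{\sigma,b}n_{1\sigma}(1-p_\sigma)X_{\sigma b}v_b=\frac{1}{N_2-\mu_2}\sum_{\sigma,b}n_{2\sigma}(1-p_\sigma)X_{\sigma b}v_b$. - (C) Balance for the positive class: the average score of positive-class members is the same in both groups, i.e. $\frac{1}{\mu_1}\sum_{\sigma,b}n_{1\sigma}p_\sigma X_{\sigma b}v_b=\frac{1}{\mu_2}\sum_{\sigma,b}n_{2\sigma}p_\sigma X_{\sigma b}v_b$. *)

(* Defs.v *)
From mathcomp Require Import all_boot all_order all_algebra.

Set Implicit Arguments.
Unset Strict Implicit.
Unset Printing Implicit Defensive.

Import Order.TTheory GRing.Theory Num.Theory.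
Local Open Scope ring_scope.

Definition group : finType := 'I_2.
Definition group1 : group := ord0.
Definition group2 : group := ord_max.

Record instance (R : realFieldType) (S : finType) := Instance {
  prob : S -> R;
  group_size : group -> R;
  freq : group -> S -> R;
  prob_in01 : forall s, 0 <= prob s <= 1;
  group_size_gt0 : forall t, 0 < group_size t;
  freq_ge0 : forall t s, 0 <= freq t s;
  freq_sum1 : forall t, \sum_s freq t s = 1;
  exhibited : forall s,
    0 < freq group1 s * group_size group1 + freq group2 s * group_size group2
}.

Record risk_assignment (R : realFieldType) (S B : finType) := RiskAssignment {
  score : B -> R;
  assign : S -> B -> R;
  score_in01 : forall b, 0 <= score b <= 1;
  assign_ge0 : forall s b, 0 <= assign s b;
  assign_sum1 : forall s, \sum_b assign s b = 1
}.

Section Fairness.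
Variables (R : realFieldType) (S : finType) (I : instance R S).

(* n_{t sigma} = a_{t sigma} N_t, a real number that need not be an integer. *)
Definition count (t : group) (s : S) : R := freq I t s * group_size I t.

Definition positives (t : group) : R := \sum_s count t s * prob I s.

Definition base_rate (t : group) : R := positives t / group_size I t.

Definition perfect_prediction : Prop :=
  forall s, prob I s = 0 \/ prob I s = 1.

Variables (B : finType) (X : risk_assignment R S B).

Definition calibrated : Prop :=
  forall (t : group) (b : B),
    \sum_s count t s * prob I s * assign X s b =
      score X b * \sum_s count t s * assign X s b.

Definition avg_score_negative (t : group) : R :=
  (group_size I t - positives t)^-1 *
    \sum_s \sum_b count t s * (1 - prob I s) * assign X s b * score X b.

Definition avg_score_positive (t : group) : R :=
  (positives t)^-1 *
    \sum_s \sum_b count t s * prob I s * assign X s b * score X b.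

Definition balanced_negative : Prop :=
  avg_score_negative group1 = avg_score_negative group2.

Definition balanced_positive : Prop :=
  avg_score_positive group1 = avg_score_positive group2.

End Fairness.

(* Main.v *)
(* By calibration the total score received by group t is mu_t. If x and y are
   the common average scores of the positive and the negative class, this reads
   x mu_t + y (N_t - mu_t) = mu_t, i.e. y N_t = (1 - x + y) mu_t. When y <> 0
   this fixes mu_t / N_t independently of t. When y = 0, no negative-class
   member receives a positive score, so someone with 0 < p_sigma < 1 lies in a
   bin of score 0, and calibration of that bin forces p_sigma = 0. *)

Require Import Defs.
From mathcomp Require Import all_boot all_order all_algebra.
From mathcomp Require Import ring lra.

Import Order.TTheory GRing.Theory Num.Theory.
Local Open Scope ring_scope.

Local Notation count := Defs.count.

Section RiskAssignment.
Variables (R : realFieldType) (S B : finType).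
Variables (I : instance R S) (X : risk_assignment R S B).

Lemma count_ge0 (t : group) (s : S) : 0 <= count I t s.
Proof. by rewrite mulr_ge0 ?freq_ge0 ?ltW ?group_size_gt0. Qed.

Lemma count_gt0_group (s : S) : exists t : group, 0 < count I t s.
Proof.
have := exhibited I s; rewrite -!/(count I _ s) => count_gt0.
have [gt0|le0] := ltP 0 (count I group1 s); first by exists group1.
by exists group2; apply: lt_le_trans count_gt0 _; rewrite gerDr.
Qed.

Lemma assign_neq0_bin (s : S) : exists b : B, assign X s b != 0.
Proof.
apply/existsP; apply: contraT; rewrite negb_exists => /forallP X0.
have := assign_sum1 X s; rewrite big1 => [/eqP|b _]; first by rewrite eq_sym oner_eq0.
by apply/eqP; move: (X0 b); rewrite negbK.
Qed.

(** The two class terms add up to [score X b * (count I t s * assign X s b)]. Summing over [s]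
    first, calibration of bin [b] trades the score for [prob I s]; then each row of [assign X] sums
    to 1. *)
Lemma calibrated_total_score (t : group) : calibrated I X ->
  \sum_s \sum_b count I t s * prob I s * assign X s b * score X b +
  \sum_s \sum_b count I t s * (1 - prob I s) * assign X s b * score X b =
  positives I t.
Proof.
move=> cal; rewrite -big_split /=.
transitivity (\sum_s \sum_b score X b * (count I t s * assign X s b)).
  by apply: eq_bigr => s _; rewrite -big_split; apply: eq_bigr => b _ /=; ring.
rewrite exchange_big /=.
under eq_bigr => b _ do rewrite -mulr_sumr -cal.
rewrite exchange_big; apply: eq_bigr => s _ /=.
by rewrite -mulr_sumr assign_sum1 mulr1.
Qed.

Lemma negative_score_ge0 (t : group) (s : S) (b : B) :
  0 <= count I t s * (1 - prob I s) * assign X s b * score X b.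
Proof.
have /andP[_ p_le1] := prob_in01 I s; have /andP[v_ge0 _] := score_in01 X b.
by do 3?[apply: mulr_ge0]; rewrite ?count_ge0 ?subr_ge0 ?assign_ge0.
Qed.

Lemma calibrated_perfect_prediction : calibrated I X ->
  (forall t : group,
     \sum_s \sum_b count I t s * (1 - prob I s) * assign X s b * score X b = 0) ->
  perfect_prediction I.
Proof.
move=> cal neg0 s.
(* The group [t] depends on [s], so [neg0] has to cover both groups. *)
have [t n_gt0] := count_gt0_group s; have [b X_neq0] := assign_neq0_bin s.
have n_neq0 := lt0r_neq0 n_gt0.
have [p1|p_neq1] := eqVneq (prob I s) 1; [by right | left].
(* A zero sum of nonnegative terms vanishes termwise, first over feature vectors, then over bins. *)
have /eqP : count I t s * (1 - prob I s) * assign X s b * score X b = 0.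
  have row_ge0 s' : 0 <= \sum_b count I t s' * (1 - prob I s') *
      assign X s' b * score X b.
    by apply: sumr_ge0 => b' _; apply: negative_score_ge0.
  have row0 := psumr_eq0P (fun s' _ => row_ge0 s') (neg0 t) (i := s) isT.
  exact: psumr_eq0P (fun b' _ => negative_score_ge0 t s b') row0 b isT.
(* Only the score is left as a factor that can be zero. *)
rewrite 3!mulf_eq0 (negPf n_neq0) (negPf X_neq0) subr_eq0 eq_sym (negPf p_neq1) /=.
(* At score 0, calibration leaves no positive-class mass in bin [b], hence none coming from [s]. *)
move=> /eqP v0; move: (cal t b); rewrite v0 mul0r => pos0.
have pos_ge0 s' : 0 <= count I t s' * prob I s' * assign X s' b.
  by have /andP[p_ge0 _] := prob_in01 I s'; do 2?[apply: mulr_ge0];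
     rewrite ?count_ge0 ?assign_ge0.
have /eqP := psumr_eq0P (fun s' _ => pos_ge0 s') pos0 (i := s) isT.
by rewrite 2!mulf_eq0 (negPf n_neq0) (negPf X_neq0) orbF => /eqP.
Qed.

End RiskAssignment.

Theorem theorem1p1 (R : realFieldType) (S : finType) (I : instance R S)
    (hmu : forall t : group, 0 < positives I t < group_size I t)
    (hfair : exists (B : finType) (X : risk_assignment R S B),
      [/\ calibrated I X, balanced_negative I X & balanced_positive I X]) :
  perfect_prediction I \/ base_rate I group1 = base_rate I group2.
Proof.
have [B [X [cal balN balP]]] := hfair.
have pos_neq0 t : positives I t != 0 by have /andP[/lt0r_neq0] := hmu t.
have neg_neq0 t : group_size I t - positives I t != 0.
  by have /andP[_ lt_mu] := hmu t; rewrite lt0r_neq0 ?subr_gt0.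
have size_neq0 t : group_size I t != 0 by rewrite lt0r_neq0 ?group_size_gt0.
have total t : avg_score_positive I X t * positives I t +
    avg_score_negative I X t * (group_size I t - positives I t) = positives I t.
  (* An average times its nonzero class size is the total score of that class. *)
  rewrite -[RHS](calibrated_total_score _ _ _ _ X t cal).
  by rewrite /avg_score_positive /avg_score_negative ![_^-1 * _]mulrC !divfK.
have [y0|y_neq0] := eqVneq (avg_score_negative I X group1) 0.
  left; apply: (calibrated_perfect_prediction _ _ _ _ X cal) => t.
  have /eqP : avg_score_negative I X t = 0.
    have [->|->] // : t = group1 \/ t = group2.
      by case: t => [[|[|//]] lt_t]; [left | right]; apply: val_inj.
    by rewrite -balN.
  by rewrite mulf_eq0 invr_eq0 (negPf (neg_neq0 t)) => /eqP.
right.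
set x := avg_score_positive I X group1; set y := avg_score_negative I X group1.
(* The resulting value is free of [t]. The premises are trivial for [group1] and are the balance
   conditions for [group2]. *)
have balance t : avg_score_positive I X t = x -> avg_score_negative I X t = y ->
    base_rate I t = y / (1 - x + y).
  move=> xE yE; have := total t; rewrite xE yE => tot.
  have muE : y * group_size I t = (1 - x + y) * positives I t by lra.
  (* Otherwise [muE] would make [y * group_size I t] zero, although both factors are nonzero. *)
  have d_neq0 : 1 - x + y != 0.
    apply: contraNneq (mulf_neq0 y_neq0 (size_neq0 t)) => d0.
    by rewrite -/y muE d0 mul0r.
  by apply/eqP; rewrite /base_rate eqr_div // muE mulrC.
by rewrite !balance.
Qed.
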